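(* Let $W^{(1)},W^{(2)}$ be the two Brownian motions in the continuous-time limit of the QSD volatility model (described in the context) in which the density $f$ drives the innovation and the density $g$ is used to compute the quasi score. Then $W^{(1)}$ and $W^{(2)}$ can be correlated only if $f$ and $g$ are different and at least one of them is asymmetric. That is, if $$\mathrm{Cov}\big[dW_t^{(1)},dW_t^{(2)}\big]=-\frac{\rho}{2\sqrt{\eta(m_2-\mu^2)}}\,dt$$ is non-zero, then $f\neq g$ and $f,g$ are not both symmetric (about $0$).
   Context: Let $f$ be a probability density on $\mathbb{R}$ with zero mean, and let $g$ be a probability density on $\mathbb{R}$ such that the quotient $g'/g$ makes sense. Let $\varphi:\mathbb{R}\to\mathbb{R}^+$ be monotonic and differentiable, $S$ continuous, and let $U$ be a random variable with density $f$. Put $$\rho=\mathbb{E}\Big[U^2\frac{g'(U)}{g(U)}\Big],\quad \eta=\mathbb{E}(U^2),\quad m_l=\frac{1}{(-2)^l}\int_{-\infty}^{\infty}\Big[1+\frac{g'(u)}{g(u)}u\Big]^l f(u)\,du,\quad \mu=m_1 .$$ QSD volatility model with time step $h>0$: $$X_{kh}^{(h)}=X_{(k-1)h}^{(h)}+c_h\lambda_{kh}^{(h)}+y_{kh}^{(h)},$$ $$\lambda_{(k+1)h}^{(h)}=\omega_h+\frac{\mu_h\alpha_hS(\lambda_{kh}^{(h)})\varphi'(\lambda_{kh}^{(h)})}{\varphi(\lambda_{kh}^{(h)})}+\beta_h\lambda_{kh}^{(h)}+\alpha_hS(\lambda_{kh}^{(h)})\Big[{}^{q}\nabla_{kh}^{(h)}-\frac{\mu\varphi'(\lambda_{kh}^{(h)})}{\varphi(\lambda_{kh}^{(h)})}\Big]$$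 (when $\mu=0$ one takes $\mu_h=0$, and the update is simply $\lambda_{(k+1)h}^{(h)}=\omega_h+\beta_h\lambda_{kh}^{(h)}+\alpha_hS(\lambda_{kh}^{(h)})\,{}^{q}\nabla_{kh}^{(h)}$). Here $y_{kh}^{(h)}=\sqrt{\varphi(\lambda_{kh}^{(h)})}\,\varepsilon_{kh}^{(h)}$, where $h^{-1/2}\varepsilon_{kh}^{(h)}$ has density $f$ conditionally on the past $\mathcal{F}_{(k-1)h}$, with $\mathcal{F}_{kh}=\sigma(Z_{kh}^{(h)},\dots,Z_0^{(h)},\lambda_0^{(h)})$, $Z_{kh}^{(h)}=(X_{kh}^{(h)},\lambda_{(k+1)h}^{(h)})$; and the quasi score ${}^{q}\nabla_{kh}^{(h)}$ is $\partial_\lambda\log q(y,\lambda)$ evaluated at $(y_{kh}^{(h)},\lambda_{kh}^{(h)})$, with $q(y,\lambda)=\frac{1}{\sqrt{\varphi(\lambda)h}}\,g\big(\frac{y}{\sqrt{\varphi(\lambda)h}}\big)$. Standing assumptions: as $h\to0$, $h^{-1}c_h\to c$, $h^{-1}\omega_h\to\omega$, $h^{-1}(1-\beta_h)\to\theta$, $h^{-1/2}\alpha_h\to\alpha\neq0$, $h^{-1/2}\mu_h\to\mu$; $\rho$ is finite; for some $\delta>0$, $\mathbb{E}|U|^{2+\delta}<\infty$ and the conditional $(2+\delta)$-th absolute moment of the quasi score given the past is finite; $\eta>0$ and the conditional second moment $\gamma(\lambda)=m_2[\varphi'(\lambda)/\varphi(\lambda)]^2$ of the quasi score is positive; $\Gamma\subset\mathbb{R}$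 is compact and $S\varphi'/\varphi$ is continuous on $\Gamma$; $4\eta(m_2-\mu^2)-\rho^2>0$; and $Z_0^{(h)}$ converges in distribution to some $Z_0$. Continuous-time limit: the step process $Z_t^{(h)}:=Z_{kh}^{(h)}$ for $kh\le t<(k+1)h$ converges weakly (Skorokhod topology) as $h\to0$ to the unique weak solution $(X_t,\lambda_t)\in\mathbb{R}\times\Gamma$ of $$dX_t=c\lambda_t\,dt+\sqrt{\varphi(\lambda_t)\eta}\,dW_t^{(1)},$$ $$d\lambda_t=\Big[\omega-\theta\lambda_t+\frac{\alpha\mu S(\lambda_t)\varphi'(\lambda_t)}{\varphi(\lambda_t)}\Big]dt+\alpha\sqrt{m_2-\mu^2}\,\frac{S(\lambda_t)\varphi'(\lambda_t)}{\varphi(\lambda_t)}\,dW_t^{(2)},$$ where $W^{(1)},W^{(2)}$ are standard Brownian motions with $\mathrm{Cov}[dW_t^{(1)},dW_t^{(2)}]=-\frac{\rho}{2\sqrt{\eta(m_2-\mu^2)}}\,dt$. A density is called symmetric if it is an even function, and asymmetric otherwise. *)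

(* Defs.v *)
From HB Require Import structures.
From mathcomp Require Import all_boot all_order all_algebra.
From mathcomp Require Import all_classical all_reals all_analysis.

Set Implicit Arguments.
Unset Strict Implicit.
Unset Printing Implicit Defensive.

Import Order.TTheory GRing.Theory Num.Theory.
Import numFieldNormedType.Exports.

Local Open Scope classical_set_scope.
Local Open Scope ring_scope.

Section densities.
Context {R : realType}.
Implicit Types f g : R -> R.

Definition is_density f :=
  [/\ measurable_fun setT f, (forall x, 0 <= f x) &
      (\int[lebesgue_measure]_x (f x)%:E = 1)%E].

Definition has_density d (T : measurableType d) (P : probability T R)
    (U : T -> R) f :=
  forall B : set R, measurable B ->
    P (U @^-1` B) = (\int[lebesgue_measure]_(x in B) (f x)%:E)%E.

(* [g'/g makes sense]: g is differentiable on the whole line, and the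
   denominator vanishes with probability 0 under f (so the division by zero
   convention is never used). *)
Definition quotient_makes_sense f g :=
  (forall x, derivable g x 1) /\
  {ae lebesgue_measure, forall x, 0 < f x -> 0 < g x}.

Definition symmetric_density f := forall x, f (- x) = f x.

End densities.

Section scores.
Context {R : realType}.
Variables f g : R -> R.

Definition rho_of d (T : measurableType d) (P : probability T R) (U : T -> R) : R :=
  fine ('E_P[fun t => (U t ^+ 2 * (derive1 g (U t) / g (U t)))%R])%E.

Definition eta_of d (T : measurableType d) (P : probability T R) (U : T -> R) : R :=
  fine ('E_P[fun t => (U t ^+ 2)%R])%E.

Definition moment (l : nat) : R :=
  ((- 2) ^+ l)^-1 *
  \int[lebesgue_measure]_u ((1 + derive1 g u / g u * u) ^+ l * f u).

Variable phi : R -> R.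

Definition quasi_density (h y l : R) : R :=
  (Num.sqrt (phi l * h))^-1 * g (y / Num.sqrt (phi l * h)).

Definition quasi_score (h y l : R) : R :=
  derive1 (fun l' => ln (quasi_density h y l')) l.

(* Conditional p-th absolute moment of the quasi score given the past, on the
   event that the current (past-measurable) value of lambda is l: under the
   conditional law, y = sqrt (phi l * h) * u with u of density f. *)
Definition cond_score_moment (p h l : R) : \bar R :=
  (\int[lebesgue_measure]_u
     (`|quasi_score h (Num.sqrt (phi l * h) * u) l| `^ p * f u)%R%:E)%E.

End scores.

(* [X k], [Lam k], [Eps k] stand for the variables at time k h; the probability
   space may depend on h. *)
Record qsd_process (R : realType) := QSDProcess {
  qsd_disp : measure_display ;
  qsd_space : measurableType qsd_disp ;
  qsd_prob : probability qsd_space R ;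
  qsd_X : nat -> {RV qsd_prob >-> R} ;
  qsd_Lam : nat -> {RV qsd_prob >-> R} ;
  qsd_Eps : nat -> {RV qsd_prob >-> R} }.

Section qsd.
Context {R : realType}.
Variables (f g phi S : R -> R) (mu : R).
Variables (c_h omega_h mu_h alpha_h beta_h h : R) (Q : qsd_process R).

Local Notation X := (qsd_X Q).
Local Notation Lam := (qsd_Lam Q).
Local Notation Eps := (qsd_Eps Q).

(* sigma (Z_k, ..., Z_0, lambda_0), where Z_j = (X_j, lambda_{j+1}) *)
Definition qsd_past (k : nat) : set (set (qsd_space Q)) :=
  <<s [set A | exists2 B : set R, measurable B &
        (exists2 j, (j <= k)%N & A = X j @^-1` B) \/
        (exists2 j, (j <= k.+1)%N & A = Lam j @^-1` B)] >>.

Definition qsd_y (k : nat) (w : qsd_space Q) : R :=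
  Num.sqrt (phi (Lam k w)) * Eps k w.

Definition qsd_nabla (k : nat) (w : qsd_space Q) : R :=
  quasi_score g phi h (qsd_y k w) (Lam k w).

(* The initial values are X_0, lambda_0 and lambda_1 (Z_0 = (X_0, lambda_1));
   the recursions run from the first step on, i.e. at the indices k.+1. *)
Definition qsd_model : Prop :=
  [/\ (forall k w, X k.+1 w = X k w + c_h * Lam k.+1 w + qsd_y k.+1 w),
      (forall k w, let l := Lam k.+1 w in
         Lam k.+2 w = omega_h
                      + mu_h * alpha_h * S l * derive1 phi l / phi l
                      + beta_h * l
                      + alpha_h * S l *
                        (qsd_nabla k.+1 w - mu * derive1 phi l / phi l)) &
      (* conditionally on the past, h^{-1/2} Eps_{k+1} has density f *)
      (forall k A B, qsd_past k A -> measurable B ->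
         qsd_prob Q (A `&` [set w | B (Eps k.+1 w / Num.sqrt h)]) =
         (qsd_prob Q A * \int[lebesgue_measure]_(u in B) (f u)%:E)%E)].

Definition qsd_Z (k : nat) (w : qsd_space Q) : R * R := (X k w, Lam k.+1 w).

Definition qsd_step (w : qsd_space Q) (t : R) : R * R :=
  qsd_Z (Num.truncn (t / h)) w.

End qsd.

Section skorokhod.
Context {R : realType}.
Implicit Types (x y : R -> R * R).

(* Paths are functions on R of which only the restriction to [0, +oo[ matters. *)
Definition cadlag x :=
  (forall t : R, 0 <= t -> x s @[s --> t^'+] --> x t) /\
  (forall t : R, 0 < t -> exists l : R * R, x s @[s --> t^'-] --> l).

Definition time_change (tau : R -> R) :=
  [/\ tau 0 = 0,
      (forall s t, 0 <= s -> s < t -> tau s < tau t),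
      {within `[0, +oo[, continuous tau} &
      tau t @[t --> +oo] --> +oo].

(* Convergence of a sequence in the (metrizable) J1 topology of D([0, +oo[). *)
Definition skorokhod_cvg (xs : nat -> R -> R * R) x :=
  exists tau : nat -> R -> R,
  [/\ (forall n, time_change (tau n)),
      (forall e, 0 < e ->
         \forall n \near \oo, forall s, 0 <= s -> `|tau n s - s| <= e) &
      (forall e N, 0 < e ->
         \forall n \near \oo, forall s, 0 <= s <= N ->
           `|xs n (tau n s) - x s| <= e)].

Definition skorokhod_continuous (F : (R -> R * R) -> R) :=
  forall xs x, (forall n, cadlag (xs n)) -> cadlag x ->
    skorokhod_cvg xs x -> F (xs n) @[n --> \oo] --> F x.

End skorokhod.

Section brownian.
Context {R : realType} d (T : measurableType d) (P : probability T R).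
Implicit Types (Fil : R -> set (set T)) (W H I : R -> T -> R).

Definition filtration Fil :=
  [/\ (forall t, 0 <= t -> sigma_algebra setT (Fil t)),
      (forall t, 0 <= t -> Fil t `<=` measurable) &
      (forall s t, 0 <= s -> s <= t -> Fil s `<=` Fil t)].

Definition adapted Fil H :=
  forall t, 0 <= t -> forall B : set R, measurable B -> Fil t (H t @^-1` B).

Definition continuous_paths H :=
  forall w, {within `[0, +oo[, continuous (fun t => H t w)}.

Definition brownian_motion Fil W :=
  [/\ P [set w | W 0 w = 0] = 1%E, adapted Fil W, continuous_paths W &
      (* W_t - W_s is N(0, t - s) and independent of Fil s *)
      (forall s t A B, 0 <= s -> s < t -> Fil s A -> measurable B ->
         P (A `&` [set w | B (W t w - W s w)]) =
         (P A * normal_prob 0 (Num.sqrt (t - s)) B)%E)].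

(* Cov[dW1_t, dW2_t] = r dt: for s < t, the conditional covariance of the
   (centered) increments given Fil s is r (t - s). *)
Definition instant_cov Fil (W1 W2 : R -> T -> R) (r : R) :=
  forall s t A, 0 <= s -> s < t -> Fil s A ->
    P.-integrable setT
      (fun w => ((W1 t w - W1 s w) * (W2 t w - W2 s w))%:E) /\
    (\int[P]_(w in A) ((W1 t w - W1 s w) * (W2 t w - W2 s w))%:E =
     P A * (r * (t - s))%:E)%E.

Definition correlated (W1 W2 : R -> T -> R) :=
  exists s t, [/\ 0 <= s, s < t &
    covariance P (fun w => W1 t w - W1 s w) (fun w => W2 t w - W2 s w) <> 0%E].

Definition cvg_in_probability (Y : nat -> T -> R) (Y0 : T -> R) :=
  forall e, 0 < e -> P [set w | e <= `|Y n w - Y0 w|] @[n --> \oo] --> 0%E.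

(* I_t = \int_0^t H dW for all t >= 0, for H continuous and adapted: limit in
   probability of the left-point Riemann sums over uniform partitions. *)
Definition ito_integral H W I :=
  forall t, 0 <= t ->
    cvg_in_probability
      (fun n w => \sum_(i < n.+1) H (t * i%:R / n.+1%:R) w *
                    (W (t * i.+1%:R / n.+1%:R) w - W (t * i%:R / n.+1%:R) w))
      (I t).

End brownian.

(* Weak solutions (X, Lam) in R x Gamma of
     dX   = b1(Lam) dt + s1(Lam) dW1,   dLam = b2(Lam) dt + s2(Lam) dW2,
     Cov[dW1, dW2] = r dt. *)
Record weak_solution (R : realType) (Gamma : set R)
    (b1 s1 b2 s2 : R -> R) (r : R) := WeakSolution {
  sol_disp : measure_display ;
  sol_space : measurableType sol_disp ;
  sol_prob : probability sol_space R ;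
  sol_fil : R -> set (set sol_space) ;
  sol_W1 : R -> {RV sol_prob >-> R} ;
  sol_W2 : R -> {RV sol_prob >-> R} ;
  sol_X : R -> {RV sol_prob >-> R} ;
  sol_Lam : R -> {RV sol_prob >-> R} ;
  sol_filP : filtration sol_fil ;
  sol_W1P : brownian_motion sol_prob sol_fil sol_W1 ;
  sol_W2P : brownian_motion sol_prob sol_fil sol_W2 ;
  sol_covP : instant_cov sol_prob sol_fil sol_W1 sol_W2 r ;
  sol_X_adapted : adapted sol_fil sol_X ;
  sol_Lam_adapted : adapted sol_fil sol_Lam ;
  sol_X_cont : continuous_paths sol_X ;
  sol_Lam_cont : continuous_paths sol_Lam ;
  sol_Gamma : forall t w, 0 <= t -> Gamma (sol_Lam t w) ;
  sol_dX : ito_integral sol_prob (fun t w => s1 (sol_Lam t w)) sol_W1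
    (fun t w => sol_X t w - sol_X 0 w -
       \int[lebesgue_measure]_(s in `[0, t]) b1 (sol_Lam s w)) ;
  sol_dLam : ito_integral sol_prob (fun t w => s2 (sol_Lam t w)) sol_W2
    (fun t w => sol_Lam t w - sol_Lam 0 w -
       \int[lebesgue_measure]_(s in `[0, t]) b2 (sol_Lam s w)) }.

Section weak_solutions.
Context {R : realType} (Gamma : set R) (b1 s1 b2 s2 : R -> R) (r : R).
Implicit Types A B : weak_solution Gamma b1 s1 b2 s2 r.

Definition sol_Z A (w : sol_space A) (t : R) : R * R :=
  (sol_X A t w, sol_Lam A t w).

Definition same_fdd A B n (ts : 'I_n -> R) :=
  forall C : 'I_n -> set (R * R), (forall i, measurable (C i)) ->
    sol_prob A [set w | forall i, C i (sol_Z w (ts i))] =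
    sol_prob B [set w | forall i, C i (sol_Z w (ts i))].

Definition unique_in_law A :=
  forall B, same_fdd A B (fun _ : 'I_1 => 0) ->
    forall n (ts : 'I_n -> R), (forall i, 0 <= ts i) -> same_fdd A B ts.

Variables (Q : R -> qsd_process R) (A : weak_solution Gamma b1 s1 b2 s2 r).

Definition initial_cvg_in_law :=
  forall G : R * R -> R, continuous G -> (exists K, forall z, `|G z| <= K) ->
    (\int[qsd_prob (Q h)]_w G (qsd_Z 0 w)) @[h --> 0^'+]
      --> \int[sol_prob A]_w G (sol_Z w 0).

(* Weak convergence, as h -> 0+, of the step processes in D([0, +oo[, R^2). *)
Definition skorokhod_weak_cvg :=
  forall F : (R -> R * R) -> R,
    skorokhod_continuous F -> (exists K, forall x, `|F x| <= K) ->
    (\int[qsd_prob (Q h)]_w F (qsd_step h w)) @[h --> 0^'+]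
      --> \int[sol_prob A]_w F (sol_Z w).

End weak_solutions.

(* Main.v *)
Require Import Defs.
From HB Require Import structures.
From mathcomp Require Import all_boot all_order all_algebra.
From mathcomp Require Import all_classical all_reals all_analysis.
From mathcomp Require Import measurable_realfun ring lra.

Set Implicit Arguments.
Unset Strict Implicit.
Unset Printing Implicit Defensive.

Import Order.TTheory GRing.Theory Num.Theory.
Import numFieldNormedType.Exports.

Local Open Scope classical_set_scope.
Local Open Scope ring_scope.

(** The limiting Brownian motions have correlation proportional to [rho], the
    expectation of [U ^ 2 * g'(U) / g(U)], so everything reduces to the
    vanishing of [rho] in two cases.

    If [f] and [g] are even, then [g'/g] is odd, so the integrand is an odd
    function of a variable with a symmetric law ([rho_eq0_symmetric]).

    If [f = g], the density cancels the denominator and [rho] is the integral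
    of [u ^ 2 * f'(u)].  Integration by parts turns it into minus twice the
    mean of [f], which is zero.  The analytic difficulty is that [f'] is only
    known to exist everywhere and to be integrable against [u ^ 2]: it need not
    be continuous, so neither the fundamental theorem of calculus for
    continuous integrands nor an absolute continuity hypothesis is at hand.
    The fact needed is the classical theorem that an everywhere differentiable
    function with Lebesgue integrable derivative is the integral of its
    derivative ([Rintegral_derive1]).  It rests on the inequality
    [|Q b - Q a| <= \int |Q'|], proved by enlarging the level sets of [|Q'|] to
    open sets of almost the same measure ([measurable_nonneg_majorant]), after
    which a continuous L1 approximation of the derivative reduces the theorem
    to the continuous case.  On the whole line the boundary terms vanish
    because the nonnegative function [u ^ 2 * f u] is integrable
    ([Rintegral_derive1_eq0]).

    Finally, [correlated] speaks of the covariance of increments, whereas the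
    weak solution only provides the conditional mean of their product.  The
    two agree because Gaussian increments, having an even density, are
    centered. *)

Local Notation leb := lebesgue_measure.

(** * Odd functions of symmetrically distributed variables *)

(** Reflection exchanges the positive and negative parts, so both have the same
    expectation.  If that is infinite, the difference is an infinite value,
    which [fine] sends to [0]. *)
Lemma fine_expectation_odd (R : realType) d (T : measurableType d)
    (P : probability T R) (X : T -> R) (k : R -> R) :
  measurable_fun setT X -> measurable_fun setT k ->
  (forall x, k (- x) = - k x) ->
  (forall B : set R, measurable B ->
     P (X @^-1` B) = P (X @^-1` (-%R @^-1` B))) ->
  fine ('E_P[fun t => k (X t)])%E = 0.
Proof.
move=> mX mk oddk symX.
pose kp : R -> \bar R := ((EFin \o k)^\+)%E.
have mkp : measurable_fun [set: R] kp.
  by apply: measurable_funepos; exact/measurable_EFinP.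
have kp0 x : (0 <= kp x)%E by exact: funepos_ge0.
have mNX : measurable_fun setT (fun t => - X t) by exact: measurableT_comp.
have posE : (\int[P]_t ((fun t => (k (X t))%:E)^\+ t) =
             \int[pushforward P X]_x kp x)%E.
  rewrite ge0_integral_pushforward// preimage_setT.
  by apply: eq_integral => t _; rewrite /kp /= !funeposE.
have negE : (\int[P]_t ((fun t => (k (X t))%:E)^\- t) =
             \int[pushforward P (fun t => (- X t)%R)]_x kp x)%E.
  rewrite ge0_integral_pushforward//.
  rewrite preimage_setT; apply: eq_integral => t _.
  by rewrite /kp /= funenegE funeposE /= oddk.
rewrite unlock integralE posE negE.
have -> : (\int[pushforward P (fun t => (- X t)%R)]_x kp x =
           \int[pushforward P X]_x kp x)%E.
  by apply: eq_measure_integral => //= B mB _; rewrite /pushforward symX.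
have : (0 <= \int[pushforward P X]_x kp x)%E by exact: integral_ge0.
by case: (integral _ _ _) => //= r _; rewrite subrr.
Qed.

Lemma symmetric_density_law (R : realType) d (T : measurableType d)
    (P : probability T R) (X : T -> R) (f : R -> R) :
  measurable_fun setT f -> (forall x, 0 <= f x) ->
  has_density P X f -> symmetric_density f ->
  forall B : set R, measurable B ->
    P (X @^-1` B) = P (X @^-1` (-%R @^-1` B)).
Proof.
move=> mf f0 Xf symf B mB.
have mN : measurable_fun [set: R] (-%R : R -> R) by exact: oppr_measurable.
have mNB : measurable (-%R @^-1` B : set R).
  by rewrite -[X in measurable X]setTI; exact: mN.
rewrite !Xf//.
transitivity (\int[pushforward lebesgue_measure
    (-%R : R -> measurableTypeR R)]_(x in B) (f x)%:E)%E.
  by apply: eq_measure_integral => //= A mA _; rewrite -lebesgue_measureN.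
rewrite ge0_integral_pushforward//.
- by apply: eq_integral => x _ /=; rewrite symf.
- by apply/measurable_EFinP; exact: measurable_funTS.
- by move=> x _; rewrite lee_fin.
Qed.

(** * Brownian increments with zero conditional covariance *)

Lemma filtration_setT (R : realType) d (T : measurableType d)
    (Fil : R -> set (set T)) (s : R) :
  filtration Fil -> 0 <= s -> Fil s setT.
Proof.
move=> [sFil _ _] s0; have [F0 FC _] := sFil s s0.
by rewrite -[X in Fil s X]setD0; exact: FC.
Qed.

Lemma brownian_increment_centered (R : realType) d (T : measurableType d)
    (P : probability T R) (Fil : R -> set (set T)) (W : R -> {RV P >-> R})
    (s t : R) :
  filtration Fil -> brownian_motion P Fil W -> 0 <= s -> s < t ->
  fine ('E_P[fun w => (W t w - W s w)%R])%E = 0.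
Proof.
move=> filP [_ _ _ incW] s0 st.
have mW : measurable_fun setT (fun w => W t w - W s w).
  exact: measurable_funB.
apply: (@fine_expectation_odd _ _ _ _ _ id) => //.
apply: (@symmetric_density_law _ _ _ _ _
  (normal_pdf 0 (Num.sqrt (t - s)))) => //.
- exact: measurable_normal_pdf.
- by move=> x; exact: normal_pdf_ge0.
- move=> B mB; have := incW s t setT B s0 st (filtration_setT filP s0) mB.
  by rewrite setTI probability_setT mul1e.
- have ts0 : Num.sqrt (t - s) != 0 by rewrite sqrtr_eq0 -ltNge subr_gt0.
  by move=> x; rewrite !normal_pdfE// //= /normal_fun !subr0 sqrrN.
Qed.

Lemma instant_cov0_uncorrelated (R : realType) d (T : measurableType d)
    (P : probability T R) (Fil : R -> set (set T)) (W1 W2 : R -> {RV P >-> R})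
    (r : R) :
  filtration Fil -> brownian_motion P Fil W1 -> brownian_motion P Fil W2 ->
  instant_cov P Fil W1 W2 r -> r = 0 -> ~ correlated P W1 W2.
Proof.
move=> filP bW1 bW2 cov0 r0 [s [t [s0 st]]]; apply.
rewrite unlock (brownian_increment_centered filP bW1 s0 st).
rewrite (brownian_increment_centered filP bW2 s0 st) unlock.
have [_] := cov0 s t setT s0 st (filtration_setT filP s0).
rewrite r0 mul0r mule0 => <-.
by apply: eq_integral => w _; rewrite !fctE /= !subr0.
Qed.

(** * Bounding an increment by the integral of the derivative *)

(** A continuity-free form of monotonicity: comparing only pairs of points that
    straddle [x] lets the supremum of the points reached from [a] be crossed
    without any regularity of [D]. *)
Lemma locally_nondecreasing_le (R : realType) (D : R -> R) (a b : R) :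
  a <= b ->
  (forall x, a <= x <= b -> exists2 e, 0 < e &
     forall s t, a <= s -> t <= b -> x - e < s <= x -> x <= t < x + e ->
       D s <= D t) ->
  D a <= D b.
Proof.
move=> ab locD.
pose A := [set x | a <= x <= b /\ D a <= D x].
have Aa : A a by split; rewrite ?lexx ?ab.
have ubA : ubound A b by move=> x [/andP[]].
have hsA : has_sup A by split; [exists a|exists b].
have supA x : A x -> x <= sup A by move=> Ax; apply: sup_upper_bound.
have a_sup : a <= sup A by exact: supA.
have sup_b : sup A <= b by apply: sup_le_ub => //; exists a.
have [e e0 De] := locD (sup A) (introT andP (conj a_sup sup_b)).
have [x [/andP[ax xb] Dx] xsup] := sup_adherent e0 hsA.
have DA t : sup A <= t < sup A + e -> t <= b -> D a <= D t.
  move=> /andP[st te] tb; apply: (le_trans Dx); apply: De => //.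
    by rewrite xsup supA//; split=> //; rewrite ax.
  by rewrite st.
have [supb|supNb] := eqVneq (sup A) b.
  by apply: DA => //; rewrite supb lexx ltrDl.
have {}supNb : sup A < b by rewrite lt_neqAle supNb.
pose t := Num.min b (sup A + e / 2).
have e20 : 0 < e / 2 by rewrite divr_gt0.
have sup_t : sup A < t by rewrite lt_min supNb ltrDl.
have tb : t <= b by rewrite ge_min lexx.
have At : A t.
  split; first by rewrite tb (le_trans a_sup)// ltW.
  apply: DA => //; rewrite (ltW sup_t) /= gt_min ltrD2l.
  by rewrite ltr_pdivrMr// ltr_pMr// ltr1n orbT.
by have := supA _ At; rewrite leNgt sup_t.
Qed.

Lemma derive1_quotient_cvg (R : realType) (F : R -> R) (x : R) :
  derivable F x 1 -> h^-1 *: (F (h + x) - F x) @[h --> 0^'] --> derive1 F x.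
Proof.
rewrite derive1E /derivable /derive.
by under eq_fun do rewrite [_ *: 1]mulr1.
Qed.

Lemma derivable_lipschitz_at (R : realType) (F : R -> R) (x e : R) :
  derivable F x 1 -> 0 < e ->
  exists2 r, 0 < r &
    forall y, `|y - x| < r -> `|F y - F x| <= (`|derive1 F x| + e) * `|y - x|.
Proof.
move=> dF e0.
have /cvgrPdist_lt/(_ _ e0) := derive1_quotient_cvg dF.
rewrite /= near_withinE => -[r r0 rP].
exists r => // y yr; have [->|yx] := eqVneq y x.
  by rewrite !subrr normr0 mulr0.
have yx0 : y - x != 0 by rewrite subr_eq0.
have := rP (y - x); rewrite /= sub0r normrN => /(_ yr yx0).
rewrite subrK => /ltW H.
have -> : F y - F x = ((y - x)^-1 *: (F y - F x)) * (y - x).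
  by rewrite [_ *: _]mulrC mulrVK// unitfE.
rewrite normrM ler_wpM2r//.
rewrite -lerBlDl; apply: le_trans H; rewrite distrC; exact: lerB_dist.
Qed.

(** The indefinite integral of [q] grows at rate [q x] near [x] only for almost
    every [x], whereas the comparison of increments needs every [x].  Enlarging
    each level set of [q] to an open set gives, at an integral cost at most
    [e'], a function growing around every [x] at a uniform rate larger than
    [q x]; it is the indefinite integral of a lower semicontinuous majorant, as
    in the theorem of Vitali and Caratheodory. *)
Lemma measurable_nonneg_majorant (R : realType) (q : R -> R) (a b e' : R) :
  a <= b -> 0 < e' -> (forall x, 0 <= q x) ->
  leb.-integrable `[a, b] (fun x => (q x)%:E) ->
  exists N : R -> R,
  [/\ N a = 0,
      ((N b)%:E <= \int[leb]_(x in `[a, b]) (q x)%:E + e'%:E)%E &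
      forall x, a <= x <= b -> exists2 c, q x < c & exists2 r, 0 < r &
        forall s t, a <= s -> t <= b -> x - r < s <= x -> x <= t < x + r ->
          c * (t - s) <= N t - N s].
Proof.
move=> ab e'0 q0 iq.
have mq : measurable_fun (`[a, b]%classic : set (measurableTypeR R)) q.
  by apply/measurable_EFinP; exact: measurable_int iq.
have lebab : leb `[a, b]%classic = (b - a)%:E.
  rewrite lebesgue_measure_itv/= lte_fin.
  by case: ltgtP ab => // -> _; rewrite subrr.
(* [K * e = e'] is the total error: [2 * e * (b - a)] from rounding [q] up to
   [c k] on each level set, and [e] from enlarging the level sets. *)
pose K := 2 * (b - a) + 1.
have K0 : 0 < K by rewrite ltr_wpDl// mulr_ge0// subr_ge0.
pose e := e' / K.
have e0 : 0 < e by exact: divr_gt0.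
pose c (k : nat) : R := (k%:R + 2) * e.
have c0 k : 0 < c k by rewrite mulr_gt0// ltr_wpDl.
pose E k : set (measurableTypeR R) :=
  `[a, b]%classic `&` q @^-1` `[k%:R * e, k.+1%:R * e[.
have mE k : measurable (E k) by apply: mq => //; exact: measurable_itv.
have lebE_fin k : (leb (E k) < +oo)%E.
  apply: (@le_lt_trans _ _ (leb `[a, b]%classic)); last by rewrite lebab ltry.
  apply: le_measure; [| |exact: subIsetl]; apply/mem_set; first exact: mE.
  exact: measurable_itv.
have gap k : 0 < e / (2 ^ k.+1)%:R / c k.
  by rewrite !divr_gt0// ltr0n expn_gt0.
(* The excess measure is scaled by [c k], so that [\sum_k c k * leb (O k)]
   exceeds the sum over the level sets by at most [e]. *)
pose O k : set (measurableTypeR R) :=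
  projT1 (cid (lebesgue_regularity_outer (mE k) (lebE_fin k) (gap k))).
have OP k : [/\ open (O k), E k `<=` O k &
    (leb (O k `\` E k) < (e / (2 ^ k.+1)%:R / c k)%:E)%E].
  by rewrite /O; case: cid.
have mO k : measurable (O k) by apply: open_measurable; have [] := OP k.
(* [M A] is the integral over [A] of the lower semicontinuous function
   [\sum_k c k * \1_(O k)], written as a series of measures. *)
pose M (A : set R) : \bar R := (\sum_(k <oo) (c k)%:E * leb (O k `&` A))%E.
have term0 A k : (0 <= (c k)%:E * leb (O k `&` A))%E.
  by rewrite mule_ge0// lee_fin ltW.
have sumE : (\sum_(k <oo) (c k)%:E * leb (E k) <=
    \int[leb]_(x in `[a, b]) (q x)%:E + (2 * e * (b - a))%:E)%E.
  have mE' k : measurable_fun (E k) (fun x => (q x + 2 * e)%:E).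
    apply/measurable_EFinP; apply: measurable_funD => //.
    by apply: measurable_funS mq => //; apply: subIsetl.
  have mqe : measurable_fun (`[a, b]%classic : set (measurableTypeR R))
      (fun x => (q x + 2 * e)%:E).
    by apply/measurable_EFinP; apply: measurable_funD.
  have bigE : \bigcup_k E k `<=` `[a, b]%classic by move=> x [k _ []].
  have qe0 x : (0 <= (q x + 2 * e)%:E)%E.
    by rewrite lee_fin addr_ge0// mulr_ge0// ltW.
  apply: (@le_trans _ _ (\sum_(k <oo) \int[leb]_(x in E k) (q x + 2 * e)%:E)%E).
    apply: lee_nneseries => [k _ _|k _].
      by rewrite mule_ge0// lee_fin ltW.
    rewrite -integral_cst//; apply: ge0_le_integral => //.
    - by move=> x _ /=; rewrite lee_fin ltW.
    - move=> x [_ /=]; rewrite in_itv /= => /andP[kq _].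
      by rewrite lee_fin /c mulrDl lerD2r.
  rewrite -ge0_integral_bigcup//; last 2 first.
  - by apply: measurable_funS mqe.
  - apply/trivIsetP => i j _ _; apply: contraNeq => /set0P[x [[_ +] [_ +]]].
    rewrite /= !in_itv/= => /andP[i1 i2] /andP[j1 j2]; apply/eqP.
    have := le_lt_trans i1 j2; have := le_lt_trans j1 i2.
    rewrite !ltr_pM2r// !ltr_nat !ltnS => ji ij.
    by apply/eqP; rewrite eqn_leq ij.
  apply: (@le_trans _ _ (\int[leb]_(x in `[a, b]) (q x + 2 * e)%:E)%E).
    by apply: ge0_subset_integral => //; exact: bigcup_measurable.
  under eq_integral do rewrite EFinD.
  rewrite ge0_integralD//=.
  - rewrite integral_cst//.
    by rewrite [X in ((2 * e)%:E * X)%E](_ : _ = (b - a)%:E) -?EFinM.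
  - by move=> x _; rewrite lee_fin q0.
  - by apply/measurable_EFinP.
  - by move=> x _; rewrite lee_fin mulr_ge0// ltW.
have Mab : (M `]a, b]%classic <= \int[leb]_(x in `[a, b]) (q x)%:E + e'%:E)%E.
  apply: (@le_trans _ _ (\sum_(k <oo)
      ((c k)%:E * leb (E k) + (e / (2 ^ k.+1)%:R)%:E))%E).
    apply: lee_nneseries => // k _.
    have -> : (e / (2 ^ k.+1)%:R)%:E =
        ((c k)%:E * (e / (2 ^ k.+1)%:R / c k)%:E)%E.
      by rewrite -EFinM [c k * _]mulrC divfK// gt_eqF.
    rewrite -ge0_muleDr//; last by rewrite lee_fin; exact: ltW (gap k).
    apply: lee_wpmul2l; first by rewrite lee_fin ltW.
    have [_ EO gapO] := OP k.
    apply: (@le_trans _ _ (leb (E k) + leb (O k `\` E k))%E); last first.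
      exact/leeD2l/ltW.
    rewrite -[X in (_ <= X)%E]measureU//; last 2 first.
    - exact: measurableD.
    - by rewrite setDIK.
    rewrite setDUK//.
    apply: le_measure; [| |exact: subIsetl]; apply/mem_set => //.
    exact: measurableI.
  apply: le_trans (epsilon_trick _ _ (ltW e0)) _.
    by move=> k; rewrite mule_ge0// lee_fin ltW.
  apply: (le_trans (leeD2r _ sumE)); rewrite -addeA leeD2l// -EFinD lee_fin.
  rewrite le_eqVlt; apply/orP; left; apply/eqP.
  have -> : 2 * e * (b - a) + e = e * K by rewrite /K; ring.
  by rewrite /e divfK// gt_eqF.
have M_additive x y : a <= x -> x <= y ->
    (M `]a, y]%classic = M `]a, x]%classic + M `]x, y]%classic)%E.
  move=> ax xy; rewrite /M -nneseriesD//; apply: eq_eseriesr => k _.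
  rewrite -ge0_muleDr//.
  congr (_ * _)%E; rewrite -measureU//.
  - rewrite -setIUr; congr (leb (_ `&` _)).
    by apply: itv_bndbnd_setU; rewrite bnd_simp.
  - exact: measurableI.
  - exact: measurableI.
  - rewrite setIACA setIid; apply/seteqP; split=> // z [_ []] /=.
    by rewrite !in_itv/= => /andP[_ zx] /andP[]; rewrite ltNge zx.
have M_ge0 A : (0 <= M A)%E by apply: nneseries_ge0 => k _ _; exact: term0.
have M_fin x : a <= x -> x <= b -> M `]a, x]%classic \is a fin_num.
  move=> ax xb; rewrite ge0_fin_numE//.
  apply: (@le_lt_trans _ _ (M `]a, b]%classic)).
    by rewrite (M_additive x b)// leeDl.
  apply: (le_lt_trans Mab); rewrite lte_add_pinfty ?ltry//.
  exact: integrable_lty.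
pose N x : R := fine (M `]a, x]%classic).
exists N; split.
- by rewrite /N set_itvoc0 /M eseries0// => k _ _; rewrite setI0 measure0 mule0.
- by rewrite fineK ?M_fin.
move=> x xab.
pose k := Num.truncn (q x / e).
have qx : k%:R * e <= q x < k.+1%:R * e.
  have qe : 0 <= q x / e by rewrite divr_ge0// ltW.
  by have := truncn_itv qe; rewrite -/k ler_pdivlMr// ltr_pdivrMr.
have [openO EO _] := OP k.
have Ox : O k x by apply: EO; split; rewrite /= in_itv.
have /nbhs_ballP[r /= r0 rO] : nbhs x (O k : set R) by exact: open_nbhs_nbhs.
exists (c k); first by rewrite /c; move: qx => /andP[_]; rewrite -natr1; lra.
exists r => // s t as_ tb /andP[rs sx] /andP[xt tr].
have st : s <= t by exact: le_trans xt.
have stO : `]s, t] `<=` O k.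
  move=> y /=; rewrite in_itv/= => /andP[sy yt]; apply: rO.
  by rewrite /ball /= ltr_norml; lra.
have Mst : ((c k * (t - s))%:E <= M `]s, t]%classic)%E.
  have -> : (c k * (t - s))%:E = ((c k)%:E * leb (O k `&` `]s, t]))%E.
    rewrite setIidr// lebesgue_measure_itv/= lte_fin.
    by case: ltgtP st => // -> _; rewrite subrr mulr0 mule0.
  by rewrite /M (nneseriesD1 (n := k))// leeDl// nneseries_ge0.
have sb : s <= b by lra.
have at_ : a <= t by lra.
have Mt := M_fin _ at_ tb.
have Ms := M_fin _ as_ sb.
rewrite -lee_fin (le_trans Mst)// EFinB !fineK// leeBrDl//.
by rewrite (M_additive s t).
Qed.

(** With [N] a majorant of [|Q'|], the function [N - Q] is nondecreasing around
    every point, hence nondecreasing. *)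
Lemma increment_le_integral_norm (R : realType) (Q : R -> R) (a b : R) :
  a <= b -> (forall x, a <= x <= b -> derivable Q x 1) ->
  leb.-integrable `[a, b] (fun x => (derive1 Q x)%:E) ->
  ((Q b - Q a)%:E <= \int[leb]_(x in `[a, b]) `|(derive1 Q x)%:E|)%E.
Proof.
move=> ab dQ iQ; apply/lee_addgt0Pr => e e0.
have [N [Na Nb locN]] := measurable_nonneg_majorant ab e0
  (fun x => normr_ge0 (derive1 Q x)) (integrable_abse iQ).
apply: le_trans Nb; rewrite lee_fin.
suff : N a - Q a <= N b - Q b by rewrite Na; lra.
apply: (@locally_nondecreasing_le _ (fun x => N x - Q x)) => // x xab.
have [c qc [r1 r10 Nincr]] := locN x xab.
have e10 : 0 < c - `|derive1 Q x| by rewrite subr_gt0.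
have [r2 r20 r2Q] := derivable_lipschitz_at (dQ x xab) e10.
have {}r2Q y : `|y - x| < r2 -> `|Q y - Q x| <= c * `|y - x|.
  by move=> /r2Q; rewrite addrCA subrr addr0.
exists (Num.min r1 r2); first by rewrite lt_min r10.
move=> s t as_ tb /andP[+ sx] /andP[xt +].
rewrite ltrBlDr -ltrBlDl -ltrBlDl !lt_min => /andP[xs1 xs2] /andP[tx1 tx2].
have Qt : Q t - Q x <= c * (t - x).
  have := r2Q t; rewrite ger0_norm ?subr_ge0// => /(_ tx2).
  exact: le_trans (ler_norm _).
have Qs : Q x - Q s <= c * (x - s).
  have := r2Q s; rewrite distrC (distrC (Q s)).
  rewrite ger0_norm ?subr_ge0// => /(_ xs2).
  exact: le_trans (ler_norm _).
have Nst : c * (t - s) <= N t - N s by apply: Nincr => //; lra.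
have cE : c * (t - s) = c * (t - x) + c * (x - s) by ring.
by move: Nst; rewrite cE; lra.
Qed.

Lemma normr_increment_le_integral (R : realType) (Q : R -> R) (a b : R) :
  a <= b -> (forall x, a <= x <= b -> derivable Q x 1) ->
  leb.-integrable `[a, b] (fun x => (derive1 Q x)%:E) ->
  (`|Q b - Q a|%:E <= \int[leb]_(x in `[a, b]) `|(derive1 Q x)%:E|)%E.
Proof.
move=> ab dQ iQ; have [_|_] := ger0P (Q b - Q a).
  exact: increment_le_integral_norm.
have dNQ x : a <= x <= b -> derivable (\- Q) x 1.
  by move=> /dQ; exact: derivableN.
have NQ'E x : a <= x <= b -> derive1 (\- Q) x = - derive1 Q x.
  by move=> /dQ Qx; rewrite !derive1E deriveN.
have iNQ : leb.-integrable `[a, b] (fun x => (derive1 (\- Q) x)%:E).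
  apply: (eq_integrable _ _ _ _ (integrableN iQ)) => //.
  by move=> x; rewrite inE/= in_itv/= => xab; rewrite NQ'E.
have -> : (\int[leb]_(x in `[a, b]) `|(derive1 Q x)%:E| =
           \int[leb]_(x in `[a, b]) `|(derive1 (\- Q) x)%:E|)%E.
  apply: eq_integral => x; rewrite inE/= in_itv/= => xab.
  by rewrite NQ'E//= normrN.
by rewrite opprD; exact: increment_le_integral_norm ab dNQ iNQ.
Qed.

(** * The fundamental theorem of calculus for integrable derivatives *)

(** Subtracting from [F] a primitive [G] of a continuous L1 approximation [p] of
    [F'] leaves a function whose derivative has small L1 norm, hence a small
    increment by the previous inequality; for [G] itself the theorem is the
    continuous one. *)
Theorem Rintegral_derive1 (R : realType) (F : R -> R) (a b : R) :
  a <= b -> (forall x, a <= x <= b -> derivable F x 1) ->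
  leb.-integrable `[a, b] (fun x => (derive1 F x)%:E) ->
  \int[leb]_(x in `[a, b]) derive1 F x = F b - F a.
Proof.
move=> ab dF iF.
have lebab : (leb (`[a, b]%classic : set R) < +oo)%E.
  by rewrite lebesgue_measure_itv/=; case: ifP => _; rewrite ltry.
have mab : measurable (`[a, b]%classic : set (measurableTypeR R)).
  exact: measurable_itv.
have [p_ [cp_ ip_ p_F]] := approximation_continuous_integrable mab lebab iF.
apply/eqP; rewrite -subr_eq0 -normr_le0.
apply/ler_addgt0Pr => e e0; rewrite add0r.
have e20 : (0 < (e / 2)%:E :> \bar R)%E by rewrite lte_fin divr_gt0.
have [n [cp ip pF]] : exists n, [/\ continuous (p_ n),
    leb.-integrable `[a, b] (EFin \o p_ n) &
    (\int[leb]_(x in `[a, b]) `|(derive1 F x - p_ n x)%:E| < (e / 2)%:E)%E].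
  have /p_F[n _ nP] := open_ereal_lt' e20.
  by exists n; split => //; exact: (nP n (leqnn n)).
move: (p_ n) cp ip pF => {p_ cp_ ip_ p_F n} p cp ip pF.
(* Starting at [a - 1] and integrating up to [b + 1] makes [a] and [b] interior
   points, where the primitive [G] is differentiable. *)
pose G x := \int[leb]_(t in `[a - 1, x]) p t.
have ipG : leb.-integrable `[a - 1, b + 1] (EFin \o p).
  apply: continuous_compact_integrable; first exact: segment_compact.
  exact: continuous_subspaceT.
have GP x : a <= x <= b -> derivable G x 1 /\ derive1 G x = p x.
  move=> /andP[ax xb].
  apply: (continuous_FTC1_closed (u := b + 1)) => //; try lra.
  exact: cp.
have Gab : G b - G a = \int[leb]_(x in `[a, b]) p x.
  have ipb : leb.-integrable `[a - 1, b] (EFin \o p).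
    apply: integrableS ipG => //; apply: subset_itvl; rewrite bnd_simp; lra.
  rewrite /G Rintegral_itvB//; [|rewrite bnd_simp; lra..].
  rewrite Rintegral_itv_obnd_cbnd//; apply: integrableS ip => //.
  exact: subset_itv_oc_cc.
have dQ x : a <= x <= b -> derivable (F \- G) x 1.
  by move=> xab; apply: derivableB; [exact: dF|have [] := GP x xab].
have Q'E x : a <= x <= b -> derive1 (F \- G) x = derive1 F x - p x.
  move=> xab; have [dG <-] := GP x xab.
  by rewrite !derive1E deriveB//; exact: dF.
have iQ : leb.-integrable `[a, b] (fun x => (derive1 (F \- G) x)%:E).
  apply: (eq_integrable _ _ _ _ (integrableB _ iF ip)) => //.
  by move=> x; rewrite inE/= in_itv/= => xab; rewrite Q'E.
have Qbound :
    (\int[leb]_(x in `[a, b]) `|(derive1 (F \- G) x)%:E| < (e / 2)%:E)%E.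
  apply: le_lt_trans pF; rewrite le_eqVlt; apply/orP; left; apply/eqP.
  by apply: eq_integral => x; rewrite inE/= in_itv/= => xab; rewrite Q'E.
have := le_lt_trans (normr_increment_le_integral ab dQ iQ) Qbound.
rewrite lte_fin /= => Qab.
have Fp : `|\int[leb]_(x in `[a, b]) derive1 F x -
            \int[leb]_(x in `[a, b]) p x| < e / 2.
  rewrite -RintegralB//; apply: le_lt_trans (le_normr_Rintegral _ _) _ => //.
    exact: (integrableB _ iF ip).
  rewrite -lte_fin /Rintegral fineK//.
  rewrite ge0_fin_numE; last by apply: integral_ge0 => x _; rewrite lee_fin.
  by rewrite (lt_trans pF) ?ltry.
move: Qab Fp; rewrite -Gab !ltr_norml => /andP[Q1 Q2] /andP[F1 F2].
by rewrite ler_norml; lra.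
Qed.

Lemma Rintegral_symmetric_itv_close (R : realType) (k : R -> R) (e : R) :
  leb.-integrable setT (fun x => (k x)%:E) -> 0 < e ->
  exists2 n : R, 0 <= n & forall x, n <= x ->
    `|\int[leb]_t k t - \int[leb]_(t in `[- x, x]) k t| < e.
Proof.
move=> ik e0.
have iK A : measurable (A : set (measurableTypeR R)) ->
    leb.-integrable A (EFin \o k).
  by move=> mA; apply: integrableS ik.
have iN A : measurable (A : set (measurableTypeR R)) ->
    leb.-integrable A (EFin \o (fun t => `|k t|)).
  by move=> mA; exact: (integrable_abse (iK _ mA)).
have mI x : measurable (`[- x, x]%classic : set (measurableTypeR R)).
  exact: measurable_itv.
have mT : measurable ([set: R] : set (measurableTypeR R)) by [].
have cvg_n : ((\int[leb]_(t in `[(- i%:R)%R, i%:R%R]) `|k t|%:E) @[i --> \oo]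
    --> \int[leb]_t `|k t|%:E)%E.
  rewrite -(bigcup_itvT true false).
  apply: ge0_nondecreasing_set_cvg_integral => //.
  - move=> i j ij; apply/subsetPset; apply: subset_itv; rewrite bnd_simp.
      by rewrite lerN2 ler_nat.
    by rewrite ler_nat.
  - by move=> i; exact: (measurable_int _ (iN _ (mI _))).
have close : (\int[leb]_t `|k t|%:E - e%:E < \int[leb]_t `|k t|%:E)%E.
  have fin := integrable_fin_num mT (iN _ mT).
  by rewrite -(fineK fin) -EFinB lte_fin ltrBlDr ltrDl.
have /cvg_n[n _ /(_ n (leqnn n)) nP] := open_ereal_gt' close.
exists n%:R => // x nx.
have mC := measurableC (mI x).
have disj : [disjoint `[- x, x]%classic & ~` `[- x, x]%classic].
  by apply/disj_setPCl.
have mU := measurableU _ _ (mI x) mC.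
have split_k := Rintegral_setU (mI x) mC (iK _ mU) disj.
have split_N := Rintegral_setU (mI x) mC (iN _ mU) disj.
rewrite setUv in split_k split_N.
rewrite split_k addrAC subrr add0r.
apply: (le_lt_trans (le_normr_Rintegral mC (iK _ mC))).
suff : \int[leb]_t `|k t| - e < \int[leb]_(t in `[- x, x]) `|k t|.
  by rewrite split_N; lra.
rewrite -lte_fin EFinB /Rintegral !fineK; last 2 first.
- exact: integrable_fin_num (iN _ (mI x)).
- exact: integrable_fin_num (iN _ mT).
apply: (lt_le_trans nP); apply: ge0_subset_integral => //.
- exact: (measurable_int _ (iN _ (mI _))).
- by apply: subset_itv; rewrite bnd_simp// lerN2.
Qed.

Lemma integrable_ge_bounded_itv (R : realType) (F : R -> R) (c : R) :
  0 < c -> (forall x, 0 <= F x) -> leb.-integrable setT (fun x => (F x)%:E) ->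
  exists K, forall a b, a <= b -> (forall x, a <= x <= b -> c <= F x) ->
    b - a <= K.
Proof.
move=> c0 F0 iF; exists ((\int[leb]_x F x) / c) => a b ab cF.
rewrite ler_pdivlMr//.
have mab : measurable (`[a, b]%classic : set (measurableTypeR R)).
  exact: measurable_itv.
have mF := measurable_int _ iF.
rewrite -lee_fin /Rintegral fineK; last exact: integrable_fin_num iF.
apply: (@le_trans _ _ (\int[leb]_(x in `[a, b]) (F x)%:E)%E); last first.
  by apply: ge0_subset_integral => //; move=> x _; rewrite lee_fin.
have -> : ((b - a) * c)%:E = (\int[leb]_(x in `[a, b]) (cst c%:E x))%E.
  transitivity (c%:E * leb (`[a, b]%classic : set R))%E.
    rewrite lebesgue_measure_itv/= lte_fin mulrC EFinM.
    by case: ltgtP ab => // -> _; rewrite subrr.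
  by rewrite integral_cst.
apply: ge0_le_integral => //.
- by move=> x _ /=; rewrite lee_fin ltW.
- exact: measurable_funTS.
Qed.

(** The integral of [F'] over [[-x, x]] is [F x - F (- x)].  If the integral over
    the line were nonzero then, according to its sign, [F x] or [F (- x)] would
    stay above a positive constant for all large [x], against the integrability
    of [F]. *)
Theorem Rintegral_derive1_eq0 (R : realType) (F : R -> R) :
  (forall x, 0 <= F x) -> (forall x, derivable F x 1) ->
  leb.-integrable setT (fun x => (F x)%:E) ->
  leb.-integrable setT (fun x => (derive1 F x)%:E) ->
  \int[leb]_x derive1 F x = 0.
Proof.
move=> F0 dF iF iF'; set I := \int[leb]_x derive1 F x.
apply/eqP/negPn/negP => I0.
have e0 : 0 < `|I| / 2 by rewrite divr_gt0// normr_gt0.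
have [n n0 nP] := Rintegral_symmetric_itv_close iF' e0.
have incr x : n <= x -> `|I - (F x - F (- x))| < `|I| / 2.
  move=> nx; rewrite -Rintegral_derive1 ?nP//; first by lra.
  by apply: integrableS iF' => //; exact: measurable_itv.
have [K KP] := integrable_ge_bounded_itv e0 F0 iF.
have [Ipos|Ineg] := ltP 0 I.
  have := KP n (n + `|K| + 1).
  have K1 := ler_norm K; have K2 := normr_ge0 K.
  suff H x : n <= x <= n + `|K| + 1 -> `|I| / 2 <= F x.
    by move=> /(_ _ H); lra.
  move=> /andP[nx _]; have := incr x nx; have := F0 (- x).
  by rewrite (gtr0_norm Ipos) ltr_norml; lra.
have := KP (- (n + `|K| + 1)) (- n).
have K1 := ler_norm K; have K2 := normr_ge0 K.
suff H x : - (n + `|K| + 1) <= x <= - n -> `|I| / 2 <= F x.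
  by move=> /(_ _ H); lra.
move=> /andP[_ xn]; have nx : n <= - x by lra.
have := incr (- x) nx; have := F0 (- x).
by rewrite (ler0_norm Ineg) opprK ltr_norml; lra.
Qed.

(** * Expectations of functions of a variable with a density *)

Lemma density_integrable (R : realType) (f : R -> R) :
  is_density f -> leb.-integrable setT (fun x => (f x)%:E).
Proof.
move=> [mf f0 f1]; apply/integrableP; split; first exact/measurable_EFinP.
under eq_integral do rewrite abse_EFin ger0_norm//.
by rewrite f1 ltry.
Qed.

(** The density agrees almost everywhere with the Radon-Nikodym derivative of
    the law of [X], for which the change of variables is known. *)
Lemma ge0_expectation_density (R : realType) d (T : measurableType d)
    (P : probability T R) (X : {RV P >-> R}) (f : R -> R) (k : R -> \bar R) :
  is_density f -> has_density P X f ->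
  measurable_fun [set: R] k -> (forall x, 0 <= k x)%E ->
  (\int[P]_t k (X t) = \int[leb]_x (k x * (f x)%:E))%E.
Proof.
move=> df Xf mk k0; have f_int := density_integrable df.
(* [X] with values in the copy of the real line on which the Lebesgue measure
   is defined, so that its law can be compared with that measure. *)
pose X' : T -> measurableTypeR R := X.
have mX' : measurable_fun setT X' by exact: measurable_funP X.
pose X'mfun : {mfun T >-> measurableTypeR R} :=
  HB.pack X' (isMeasurableFun.Build _ _ _ _ _ mX').
pose nu : probability (measurableTypeR R) R := distribution P X'mfun.
have nuE A : measurable A -> nu A = (\int[leb]_(x in A) (f x)%:E)%E.
  by move=> mA; exact: Xf.
have nu_ac : nu `<< @lebesgue_measure R.
  apply/null_content_dominatesP => A mA A0.
  rewrite nuE// null_set_integral//; apply: measurable_funTS.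
  exact: (measurable_int _ f_int).
have density_nu : ae_eq leb setT
    (Radon_Nikodym_SigmaFinite.f nu leb) (EFin \o f).
  apply: integral_ae_eq => //.
  - exact: Radon_Nikodym_SigmaFinite.f_integrable.
  - exact: (measurable_int _ f_int).
  - by move=> A _ mA; rewrite -nuE// -Radon_Nikodym_SigmaFinite.f_integral.
transitivity (\int[nu]_x k x)%E.
  by rewrite ge0_integral_pushforward// preimage_setT.
rewrite -(Radon_Nikodym_SigmaFinite.change_of_variables nu_ac k0)//.
apply: ae_eq_integral => //.
- apply: emeasurable_funM => //.
  exact: (measurable_int _ (Radon_Nikodym_SigmaFinite.f_integrable nu_ac)).
- by apply: emeasurable_funM => //; exact: (measurable_int _ f_int).
- exact: ae_eqe_mul2l.
Qed.

Lemma integrable_density (R : realType) d (T : measurableType d)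
    (P : probability T R) (X : {RV P >-> R}) (f k : R -> R) :
  is_density f -> has_density P X f -> measurable_fun [set: R] k ->
  P.-integrable setT (fun t => (k (X t))%:E) ->
  leb.-integrable setT (fun x => (k x * f x)%:E).
Proof.
move=> df Xf mk /integrableP[_ ik]; have [mf f0 _] := df.
apply/integrableP; split.
  by apply/measurable_EFinP; exact: measurable_funM.
have mak : measurable_fun [set: R] (fun x => `|k x|%:E).
  by apply/measurable_EFinP; exact: measurableT_comp.
have k0 x : (0 <= `|k x|%:E)%E by rewrite lee_fin.
move: ik; rewrite (ge0_expectation_density df Xf mak k0).
congr (_ < _)%E; apply: eq_integral => x _.
by rewrite -EFinM/= normrM (ger0_norm (f0 x)).
Qed.

Lemma expectation_density (R : realType) d (T : measurableType d)
    (P : probability T R) (X : {RV P >-> R}) (f k : R -> R) :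
  is_density f -> has_density P X f -> measurable_fun [set: R] k ->
  ('E_P[fun t => k (X t)] = \int[leb]_x (k x * f x)%:E)%E.
Proof.
move=> df Xf mk; have [_ f0 _] := df.
have mkE : measurable_fun [set: R] (EFin \o k) by exact/measurable_EFinP.
have mkp : measurable_fun [set: R] ((EFin \o k)^\+)%E.
  exact: measurable_funepos.
have mkn : measurable_fun [set: R] ((EFin \o k)^\-)%E.
  exact: measurable_funeneg.
rewrite unlock [LHS]integralE [RHS]integralE; congr (_ - _)%E.
- transitivity (\int[P]_t ((EFin \o k)^\+ (X t)))%E.
    by apply: eq_integral => t _; rewrite !funeposE.
  rewrite (ge0_expectation_density df Xf mkp (funepos_ge0 _)).
  apply: eq_integral => x _; rewrite !funeposE/=.
  by rewrite -!EFin_max -EFinM maxr_pMl// mul0r.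
- transitivity (\int[P]_t ((EFin \o k)^\- (X t)))%E.
    by apply: eq_integral => t _; rewrite !funenegE.
  rewrite (ge0_expectation_density df Xf mkn (funeneg_ge0 _)).
  apply: eq_integral => x _; rewrite !funenegE/=.
  by rewrite -!EFin_max -EFinM maxr_pMl// mul0r mulNr.
Qed.

(** * Vanishing of the correlation coefficient *)

Lemma derivable_continuous (R : realType) (g : R -> R) :
  (forall x, derivable g x 1) -> continuous g.
Proof.
by move=> dg x; apply: differentiable_continuous; apply/derivable1_diffP.
Qed.

Lemma measurable_derive1 (R : realType) (g : R -> R) :
  (forall x, derivable g x 1) -> measurable_fun [set: R] (derive1 g).
Proof.
move=> dg.
have mg : measurable_fun [set: R] g.
  by apply: continuous_measurable_fun; exact: derivable_continuous.
pose h (n : nat) x : R := n.+1%:R * (g (n.+1%:R^-1 + x) - g x).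
apply: (@measurable_fun_cvg _ _ _ [set: R] h) => //.
  move=> n; apply: measurable_funM => //; apply: measurable_funB => //.
  by apply: measurableT_comp => //; exact: measurable_funD.
move=> x _.
have step0 : (n.+1%:R^-1 : R) @[n --> \oo] --> 0^'.
  move=> A /(@cvg_harmonic R)[N _ NA]; exists N => // n /NA /=; apply.
  by rewrite invr_eq0 pnatr_eq0.
have := cvg_comp _ _ step0 (derive1_quotient_cvg (dg x)).
apply: cvg_trans; apply: near_eq_cvg; apply: nearW => n /=.
by rewrite invrK.
Qed.

Lemma measurable_invr (R : realType) :
  measurable_fun [set: R] (GRing.inv : R -> R).
Proof.
have mC0 : measurable (~` [set 0 : R]).
  by apply: measurableC; exact: measurable_set1.
rewrite -(setUv [set 0 : R]); apply/measurable_funU => //; split.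
  exact: measurable_fun_set1.
apply: open_continuous_measurable_fun.
  by apply: closed_openC; exact: closed_eq.
by move=> x /set_mem /eqP x0; exact: inv_continuous.
Qed.

Lemma measurable_score (R : realType) (g : R -> R) :
  (forall x, derivable g x 1) ->
  measurable_fun [set: R] (fun u => u ^+ 2 * (derive1 g u / g u)).
Proof.
move=> dg; apply: measurable_funM => //.
apply: measurable_funM; first exact: measurable_derive1.
apply: measurableT_comp; first exact: measurable_invr.
apply: continuous_measurable_fun; exact: derivable_continuous.
Qed.

Lemma derive1_even (R : realType) (g : R -> R) :
  (forall x, derivable g x 1) -> (forall x, g (- x) = g x) ->
  forall x, derive1 g (- x) = - derive1 g x.
Proof.
move=> dg eveng x.
have {1}-> : g = g \o -%R by apply/funext => y; rewrite /= eveng.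
have dN (y : R) : derivable (-%R : R -> R) y 1 by exact: derivable_opp.
rewrite derive1_comp// opprK (_ : derive1 (-%R : R -> R) (- x) = -1) ?mulrN1//.
by rewrite derive1E (deriveN (f := id))// derive_id.
Qed.

Lemma derive1_eq0_at_zero (R : realType) (f : R -> R) (x : R) :
  (forall x, derivable f x 1) -> (forall x, 0 <= f x) -> f x = 0 ->
  derive1 f x = 0.
Proof.
move=> df f0 fx0; rewrite derive1E.
have [] // := @derive1_at_min R f (x - 1) (x + 1) x.
- lra.
- by rewrite in_itv/=; lra.
- by move=> t _; rewrite fx0.
Qed.

Lemma rho_eq0_symmetric (R : realType) d (T : measurableType d)
    (P : probability T R) (U : {RV P >-> R}) (f g : R -> R) :
  is_density f -> has_density P U f -> (forall x, derivable g x 1) ->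
  symmetric_density f -> symmetric_density g -> rho_of g P U = 0.
Proof.
move=> [mf f0 _] Uf dg symf symg.
apply: (@fine_expectation_odd _ _ _ P U
  (fun u => u ^+ 2 * (derive1 g u / g u))) => //.
- exact: measurable_score.
- by move=> x; rewrite sqrrN symg derive1_even// mulNr mulrN.
- exact: symmetric_density_law symf.
Qed.

(** Against the density, the integrand of [rho] is [u ^ 2 * f' u], that is
    [F' u - 2 * (u * f u)] with [F u = u ^ 2 * f u].  The first term integrates
    to zero over the line and so does the second, [f] having zero mean. *)
Lemma rho_eq0_same_density (R : realType) d (T : measurableType d)
    (P : probability T R) (U : {RV P >-> R}) (f : R -> R) :
  is_density f -> has_density P U f -> (forall x, derivable f x 1) ->
  (\int[leb]_u (u * f u)%:E = 0)%E ->
  0 < eta_of P U ->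
  P.-integrable setT (fun t => (U t ^+ 2 * (derive1 f (U t) / f (U t)))%:E) ->
  rho_of f P U = 0.
Proof.
move=> densf Uf df mean0 eta0 irho; have [mf f0 _] := densf.
(* Where [f] vanishes it attains its minimum, so [f'] vanishes there too. *)
have scoreE u : u ^+ 2 * (derive1 f u / f u) * f u = u ^+ 2 * derive1 f u.
  have [fu0|fu0] := eqVneq (f u) 0; last by rewrite -mulrA divfK.
  by rewrite fu0 derive1_eq0_at_zero// !mulr0.
have mscore := measurable_score df.
have i_f := density_integrable densf.
have i_u2f : leb.-integrable setT (fun u => (u ^+ 2 * f u)%:E).
  apply: (integrable_density (k := fun u => u ^+ 2) densf Uf) => //.
  apply/integrableP; split.
    by apply/measurable_EFinP; apply: measurable_funX.
  (* [fine] sends infinite values to [0], so a positive [eta] is finite. *)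
  move: eta0; rewrite /eta_of unlock.
  under [in X in _ -> X]eq_integral do rewrite abse_EFin ger0_norm ?sqr_ge0//.
  by case: (integral _ _ _) => //= [r _|]; rewrite ?ltry ?ltxx.
have i_u2f' : leb.-integrable setT (fun u => (u ^+ 2 * derive1 f u)%:E).
  have := integrable_density densf Uf mscore irho.
  by under eq_fun do rewrite scoreE.
have i_uf : leb.-integrable setT (fun u => (u * f u)%:E).
  apply: (le_integrable _ _ _ (integrableD _ i_f i_u2f)) => //.
    by apply/measurable_EFinP; apply: measurable_funM.
  move=> u _; rewrite /= !lee_fin normrM (ger0_norm (f0 u)).
  rewrite [leRHS]ger0_norm; last by rewrite addr_ge0// mulr_ge0// sqr_ge0.
  have -> : f u + u ^+ 2 * f u = (1 + u ^+ 2) * f u by ring.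
  rewrite ler_wpM2r//; have := sqr_ge0 (`|u| - 1); have := normr_ge0 u.
  by rewrite -(real_normK (num_real u)); nra.
pose F u := u ^+ 2 * f u.
have dF u : derivable F u 1.
  by apply: derivableM => //; exact: exprn_derivable.
have F'E u : derive1 F u = 2 * (u * f u) + u ^+ 2 * derive1 f u.
  rewrite !derive1E (deriveM (@exprn_derivable R 2 u 1) (df u)).
  by rewrite exp_derive /GRing.scale/=; ring.
have i_2uf : leb.-integrable setT (fun u => (2 * (u * f u))%:E).
  exact: (integrableZl _ 2 i_uf).
have iF' : leb.-integrable setT (fun u => (derive1 F u)%:E).
  under eq_fun do rewrite F'E EFinD.
  exact: (integrableD _ i_2uf i_u2f').
have F0 u : 0 <= F u by rewrite mulr_ge0// sqr_ge0.
have := Rintegral_derive1_eq0 F0 dF i_u2f iF'.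
have mean0R : \int[leb]_u (u * f u) = 0 by rewrite /Rintegral mean0.
under eq_Rintegral do rewrite F'E.
rewrite RintegralD//.
rewrite RintegralZl// mean0R mulr0 add0r => I0.
rewrite /rho_of (expectation_density densf Uf mscore).
by rewrite -[RHS]I0; congr fine; apply: eq_integral => u _; rewrite /= scoreE.
Qed.

Theorem corollary4 (R : realType)
  (f g phi S : R -> R)
  (hf : is_density f) (hg : is_density g)
  (hgg : quotient_makes_sense f g)
  (hphi_pos : forall x, 0 < phi x)
  (hphi_mono : {homo phi : x y / x <= y} \/ {homo phi : x y /~ x <= y})
  (hphi_diff : forall x, derivable phi x 1)
  (hS : continuous S)
  (d : measure_display) (T : measurableType d) (P : probability T R)
  (U : {RV P >-> R}) (hU : has_density P U f)
  (hf_mean : (\int[lebesgue_measure]_u (u * f u)%:E = 0)%E)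
  (rho eta mu m2 : R)
  (hrho : rho = rho_of g P U) (heta : eta = eta_of P U)
  (hmu : mu = moment f g 1) (hm2 : m2 = moment f g 2)
  (c_ omega_ mu_ alpha_ beta_ : R -> R)
  (c omega theta alpha : R)
  (Q : R -> qsd_process R)
  (hQ : forall h, 0 < h ->
     qsd_model f g phi S mu (c_ h) (omega_ h) (mu_ h) (alpha_ h) (beta_ h) h (Q h))
  (hmu0 : mu = 0 -> forall h, 0 < h -> mu_ h = 0)
  (hc : c_ h / h @[h --> 0^'+] --> c)
  (homega : omega_ h / h @[h --> 0^'+] --> omega)
  (htheta : (1 - beta_ h) / h @[h --> 0^'+] --> theta)
  (halpha : alpha_ h / Num.sqrt h @[h --> 0^'+] --> alpha)
  (halpha0 : alpha != 0)
  (hmu_lim : mu_ h / Num.sqrt h @[h --> 0^'+] --> mu)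
  (hrho_fin : P.-integrable setT
     (fun t => (U t ^+ 2 * (derive1 g (U t) / g (U t)))%:E))
  (hmoments : exists2 delta : R, 0 < delta &
     ('E_P[fun t => (`|U t| `^ (2 + delta))%R] < +oo)%E /\
     forall h l : R, 0 < h -> (cond_score_moment f g phi (2 + delta) h l < +oo)%E)
  (heta_pos : 0 < eta)
  (hgamma_pos : forall l, 0 < m2 * (derive1 phi l / phi l) ^+ 2)
  (Gamma : set R) (hGamma : compact Gamma)
  (hSphi : {within Gamma, continuous (fun l => S l * derive1 phi l / phi l)})
  (hdisc : 0 < 4 * eta * (m2 - mu ^+ 2) - rho ^+ 2)
  (lim : weak_solution Gamma
     (fun l => c * l)
     (fun l => Num.sqrt (phi l * eta))
     (fun l => omega - theta * l + alpha * mu * S l * derive1 phi l / phi l)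
     (fun l => alpha * Num.sqrt (m2 - mu ^+ 2) * (S l * derive1 phi l / phi l))
     (- (rho / (2 * Num.sqrt (eta * (m2 - mu ^+ 2))))))
  (hlim_unique : unique_in_law lim)
  (hinit : initial_cvg_in_law Q lim)
  (hlim : skorokhod_weak_cvg Q lim) :
  (correlated (sol_prob lim) (sol_W1 lim) (sol_W2 lim) ->
     f <> g /\ ~ (symmetric_density f /\ symmetric_density g)) /\
  (- (rho / (2 * Num.sqrt (eta * (m2 - mu ^+ 2)))) <> 0 ->
     f <> g /\ ~ (symmetric_density f /\ symmetric_density g)).
Proof.
have [dg _] := hgg.
have rho0 : (f = g \/ symmetric_density f /\ symmetric_density g) -> rho = 0.
  rewrite hrho => -[fg|[symf symg]]; last exact: rho_eq0_symmetric hU dg symf symg.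
  by subst f; apply: rho_eq0_same_density => //; rewrite -heta.
have nonzero : rho <> 0 ->
    f <> g /\ ~ (symmetric_density f /\ symmetric_density g).
  by move=> rhoN0; split=> H; apply: rhoN0; apply: rho0; [left|right].
split=> [corr|r0]; apply: nonzero => rhoE; last first.
  by apply: r0; rewrite rhoE mul0r oppr0.
have cov := @sol_covP _ _ _ _ _ _ _ lim.
apply: instant_cov0_uncorrelated cov _ corr.
- exact: sol_filP.
- exact: sol_W1P.
- exact: sol_W2P.
- by rewrite rhoE mul0r oppr0.
Qed.
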